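(* Let $G : [a,b] \to \mathbb{R}$ be differentiable with continuous derivative $g$, and let $f$ be a continuous real-valued function on a closed interval $[c,d]$ (with $c<d$) containing $G([a,b])$. Let $F$ be any antiderivative of $f$ on $[c,d]$. Then $F \circ G$ is differentiable on $[a,b]$ with \[ \frac{d}{dx}\bigl(F(G(x))\bigr) = f(G(x)) \cdot g(x) \] for every $x \in [a,b]$.
   Context: The derivative of a function $H : [a,b]\to\mathbb{R}$ at $x \in (a,b)$ is $\frac{d}{dx}H(x) := \lim_{h\to 0} \frac{H(x+h)-H(x)}{h}$ when the limit exists; at the endpoints of the interval the corresponding one-sided limits are used. An antiderivative of $f$ on $[c,d]$ is a differentiable function $F : [c,d]\to\mathbb{R}$ whose derivative equals $f$ at every point of $[c,d]$. *)

(* Defs.v *)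
From mathcomp Require Import all_boot all_order all_algebra.
From mathcomp Require Import all_classical all_reals all_analysis.
Set Implicit Arguments.
Unset Strict Implicit.
Unset Printing Implicit Defensive.
Import Order.TTheory GRing.Theory Num.Theory.
Import numFieldNormedType.Exports.
Local Open Scope classical_set_scope.
Local Open Scope ring_scope.

Definition diff_quotient (R : realType) (H : R -> R) (x h : R) : R :=
  (H (x + h) - H x) / h.

(* A function on [a, b] is represented by a total function R -> R; with the
   one-sided limits at the endpoints, only its values on [a, b] matter.
   Intended for a < b and x in [a, b]: exactly one clause then applies, and
   for x outside [a, b] the predicate is vacuous. *)
Definition has_derivative_at (R : realType) (a b : R) (H : R -> R) (x l : R)
    : Prop :=
  [/\ a < x < b -> diff_quotient H x h @[h --> 0^'] --> l,
      x = a -> diff_quotient H x h @[h --> 0^'+] --> l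
    & x = b -> diff_quotient H x h @[h --> 0^'-] --> l].

Definition has_derivative_on (R : realType) (a b : R) (H H' : R -> R) : Prop :=
  forall x : R, x \in `[a, b] -> has_derivative_at a b H x (H' x).

Definition antiderivative (R : realType) (c d : R) (f F : R -> R) : Prop :=
  has_derivative_on c d F f.

(* Main.v *)
(** The slope of [H] at [x], completed by the value [l] at increment [0], is
    continuous at [0] along the admissible increments iff [H] has derivative [l]
    at [x] (Caratheodory). The completed slope of [F \o G] is the product of the
    completed slope of [F] at the increment of [G] and the completed slope of
    [G], and this needs no case distinction on whether [G (x + h) = G x]. *)
Require Import Defs.
From mathcomp Require Import all_boot all_order all_algebra.
From mathcomp Require Import all_classical all_reals all_analysis.
From mathcomp Require Import lra.
Import Order.TTheory GRing.Theory Num.Theory.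
Import numFieldNormedType.Exports.
Local Open Scope classical_set_scope.
Local Open Scope ring_scope.

Definition increments {R : realType} (a b x : R) : set R :=
  [set h | x + h \in `[a, b]].

Definition slope {R : realType} (H : R -> R) (x l h : R) : R :=
  if h == 0 then l else diff_quotient H x h.

(** Free of division, so it survives [h = 0] for any [l]; this is what later admits a vanishing
    increment of [G]. *)
Lemma slopeE {R : realType} (H : R -> R) (x l h : R) :
  H (x + h) - H x = slope H x l h * h.
Proof.
rewrite /slope; case: eqP => [->|/eqP h0]; first by rewrite addr0 subrr mulr0.
by rewrite /diff_quotient divfK.
Qed.

(** Near [0] the admissible increments are all of them at an interior [x], those [>= 0] at [a] and
    those [<= 0] at [b], so one filter covers the three limits. Including the increment [0] is
    harmless, as the slope there is [l] itself. *)
Lemma has_derivative_atP {R : realType} {a b x : R} (l : R) (H : R -> R) :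
  a < b -> x \in `[a, b] ->
  has_derivative_at a b H x l <->
  slope H x l h @[h --> within (increments a b x) (nbhs 0)] --> l.
Proof.
move=> ltab; rewrite in_itv /= => /andP[ax xb]; split.
- move=> [Hi Ha Hb]; apply/cvgrPdist_lt => e e0; rewrite near_withinE.
  suff : \forall h \near (0 : R), h != 0 -> increments a b x h ->
      `|l - diff_quotient H x h| < e.
    apply: filterS => h He hab; rewrite /slope.
    by case: eqP => [_|/eqP h0]; [rewrite subrr normr0 | exact: He].
  have [xa|xa] := eqVneq x a.
    move/cvgrPdist_lt : (Ha xa) => /(_ e e0); rewrite /at_right near_withinE; apply: filterS => h He h0.
    rewrite /increments /= in_itv /= => /andP[axh _]; apply: He.
    by rewrite lt_neqAle eq_sym h0 /=; lra.
  have [xb'|xb'] := eqVneq x b.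
    move/cvgrPdist_lt : (Hb xb') => /(_ e e0); rewrite /at_left near_withinE; apply: filterS => h He h0.
    rewrite /increments /= in_itv /= => /andP[_ xhb]; apply: He.
    by rewrite lt_neqAle h0 /=; lra.
  have : a < x < b by rewrite !lt_neqAle eq_sym xa ax xb' xb.
  move=> /Hi /cvgrPdist_lt /(_ e e0); rewrite /dnbhs near_withinE; apply: filterS => h He h0 _.
  exact: He.
- move=> Hs.
  have near0 (e : R) : 0 < e -> \forall h \near (0 : R),
      h != 0 -> increments a b x h -> `|l - diff_quotient H x h| < e.
    move=> e0; move/cvgrPdist_lt : Hs => /(_ e e0); rewrite near_withinE; apply: filterS => h He h0.
    by move=> /He; rewrite /slope (negbTE h0).
  have small (e : R) : 0 < e -> \forall h \near (0 : R), `|h| < e.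
    by move=> e0; exact: nbhs0_lt.
  split=> [/andP[ax' xb']|xa|xb']; apply/cvgrPdist_lt => e e0.
  (* Increments shorter than both distances to the endpoints are admissible. *)
  + have xa0 : 0 < x - a by lra.
    have bx0 : 0 < b - x by lra.
    near=> h; have h0 : h != 0 by near: h; exact: nbhs_dnbhs_neq.
    suff : increments a b x h by move: h0; near: h; apply: nbhs_dnbhs; exact: near0.
    have : `|h| < x - a by near: h; apply: nbhs_dnbhs; exact: small.
    have : `|h| < b - x by near: h; apply: nbhs_dnbhs; exact: small.
    by rewrite /increments /= in_itv /= !ltr_norml; lra.
  (* A positive increment from [a] is admissible once below [b - a], which is positive by [ltab]. *)
  + have ba0 : 0 < b - a by lra.
    rewrite near_withinE; apply: filterS2 (near0 _ e0) (small _ ba0) => h He.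
    rewrite ltr_norml => /andP[_ hb] h0; apply: He; first by rewrite gt_eqF.
    by rewrite /increments /= in_itv /=; lra.
  + have ba0 : 0 < b - a by lra.
    rewrite near_withinE; apply: filterS2 (near0 _ e0) (small _ ba0) => h He.
    rewrite ltr_norml => /andP[ha _] h0; apply: He; first by rewrite lt_eqF.
    by rewrite /increments /= in_itv /=; lra.
Unshelve. all: by end_near. Qed.

Theorem corollary7p3 (R : realType) (a b c d : R) (G g f F : R -> R)
  (ltab : a < b) (ltcd : c < d)
  (derG : has_derivative_on a b G g)
  (contg : {within `[a, b], continuous g})
  (contf : {within `[c, d], continuous f})
  (rangeG : G @` `[a, b] `<=` `[c, d])
  (antiF : antiderivative c d f F) :
  has_derivative_on a b (F \o G) (fun x : R => f (G x) * g x).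
Proof.
move=> x xab; have Gx_cd : G x \in `[c, d] by apply: rangeG; exists x.
have /(has_derivative_atP _ _ ltab xab) slG := derG x xab.
have /(has_derivative_atP _ _ ltcd Gx_cd) slF := antiF (G x) Gx_cd.
apply/(has_derivative_atP _ _ ltab xab).
pose k h := G (x + h) - G x.
(* The slope of [F] may be composed with [k] only if [k] tends to [0] through increments admissible
   for [F] at [G x]. *)
have k0 : k h @[h --> within (increments a b x) (nbhs 0)] -->
    within (increments c d (G x)) (nbhs 0).
  have kcvg : k h @[h --> within (increments a b x) (nbhs 0)] --> (0 : R).
    (* Differentiability gives continuity: [k h] is a convergent slope times [h]. *)
    have : slope G x (g x) h * h @[h --> within (increments a b x) (nbhs 0)] -->
        g x * 0 by apply: cvgM slG _; exact: cvg_within.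
    rewrite mulr0; apply: cvg_trans; apply: near_eq_cvg; near=> h.
    by rewrite /k (slopeE _ _ (g x)).
  move=> A /kcvg kA.
  have : \forall h \near 0, increments a b x h ->
      increments c d (G x) (k h) -> A (k h) by exact: kA.
  apply: (@filterS _ (nbhs 0) _ _ (fun h => increments a b x h -> A (k h))).
  (* Admissibility of [k h] is [rangeG] at [x + h], since [G x + k h = G (x + h)]. *)
  move=> h + hab => /(_ hab); apply.
  by rewrite /increments /k /= addrC subrK; apply: rangeG; exists (x + h).
have : slope F (G x) (f (G x)) (k h) * slope G x (g x) h
    @[h --> within (increments a b x) (nbhs 0)] --> f (G x) * g x.
  by apply: cvgM slG; exact: cvg_comp k0 slF.
apply: cvg_trans; apply: near_eq_cvg; near=> h.
(* At [h = 0] also [k h = 0], and both sides are the product of the completing values. Otherwise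
   [slopeE] for [F] and then for [G] leaves a factor [h] to cancel. *)
have [->|h0] := eqVneq h 0; first by rewrite /slope /k addr0 subrr eqxx.
rewrite [RHS]/slope (negbTE h0) /diff_quotient /=.
have -> : G (x + h) = G x + k h by rewrite /k subrKC.
have kE : k h = slope G x (g x) h * h by exact: slopeE.
by rewrite (slopeE _ _ (f (G x))) [X in _ * X / h]kE mulrA mulfK.
Unshelve. all: by end_near. Qed.
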